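(* Let $\hat F$ be an admissible extended frame on a domain $\Omega\subset\mathbb R^2$ with coefficients $A^i,B^i$, and let $F=\hat F|_{\lambda=1}$ and $\nu=\mathrm{Ad}_Fe_3$. For $\zeta\in\mathbb R\setminus\{0\}$ put $$G(\zeta)=\hat F|_{\lambda=\zeta^2}\,\exp\big(\tfrac12\log\zeta\;e_3\big)\quad(\zeta>0),\qquad G(\zeta)=e_3\,\hat F|_{\lambda=\zeta^2}\,e_3\,\exp\big(\tfrac12\log|\zeta|\;e_3\big)\quad(\zeta<0).$$ Then $G(\zeta)$ takes values in $SL(2,\mathbb R)$, $G(1)=F$, and $$G^{-1}dG=\big(A^3e_3+\zeta(A^1\xi_1+A^2\xi_2)\big)\,dx+\big(B^3e_3+\zeta^{-1}(B^1\xi_1+B^2\xi_2)\big)\,dy.$$ Thus $\nu$ is harmonic in the null coordinates $(x,y)$, and, up to a left factor constant on $\Omega$, $\zeta\mapsto G(\zeta)$ is an extended frame of the harmonic map $\nu$ (with spectral parameter $\zeta$), with $\beta_0=A^3e_3$, $\beta_1=A^1\xi_1+A^2\xi_2$, $\gamma_0=B^3e_3$ and $\gamma_{-1}=B^1\xi_1+B^2\xi_2$.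
   Context: Put $e_1=\begin{pmatrix}0&-1\\1&0\end{pmatrix}$, $e_2=\begin{pmatrix}0&1\\1&0\end{pmatrix}$, $e_3=\begin{pmatrix}-1&0\\0&1\end{pmatrix}$, $\xi_1=\begin{pmatrix}0&0\\1&0\end{pmatrix}$, $\xi_2=\begin{pmatrix}0&1\\0&0\end{pmatrix}$, $\mathrm{Ad}_FX=FXF^{-1}$, $\mathfrak k=\mathbb Re_3$, $\mathfrak p=\operatorname{span}(e_1,e_2)=\operatorname{span}(\xi_1,\xi_2)$. On $\mathfrak{sl}(2,\mathbb R)$ let $\langle X,Y\rangle=\tfrac12\operatorname{tr}(XY)$ and $\mathbb S^2_1=\{X\in\mathfrak{sl}(2,\mathbb R):\langle X,X\rangle=1\}$. All maps are smooth; a domain is a connected open set. An admissible extended frame on $\Omega$ is a family of maps $\hat F|_\lambda:\Omega\to SL(2,\mathbb R)$, depending smoothly on $\lambda\in\mathbb R\setminus\{0\}$ (i.e. a map into the loop group $\Lambda SL(2,\mathbb R)$), with $$\hat F^{-1}d\hat F=(\lambda A^1\xi_1+A^2\xi_2+A^3e_3)\,dx+(B^1\xi_1+\lambda^{-1}B^2\xi_2+B^3e_3)\,dy,$$ where $A^i,B^i$ are real functions of $(x,y)$ independent of $\lambda$. (In the paper $(x,y)$ are null coordinates of the first fundamental form of the constant mean curvature surfaces obtained from $\hat F$.) A map $\nu:\Omega\to\mathbb S^2_1$ is harmonic for the Lorentz structure with null coordinates $(x,y)$ if and only if $[\nu,\nu_{xy}]=0$. For a frame $F$ of $\nu$ (i.e.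 $\nu=\mathrm{Ad}_Fe_3$) write $F^{-1}F_x=\beta_0+\beta_1$, $F^{-1}F_y=\gamma_0+\gamma_{-1}$ with $\beta_0,\gamma_0\in\mathfrak k$ and $\beta_1,\gamma_{-1}\in\mathfrak p$. An extended frame of the harmonic map $\nu$ with spectral parameter $\zeta$ is a family, indexed by $\zeta\in\mathbb R\setminus\{0\}$, of maps $\Omega\to SL(2,\mathbb R)$ which equals $F$ at $\zeta=1$ and has Maurer–Cartan form $(\beta_0+\zeta\beta_1)\,dx+(\gamma_0+\zeta^{-1}\gamma_{-1})\,dy$. *)

(* Defs.v *)
From mathcomp Require Import all_boot all_order all_algebra.
From mathcomp Require Import all_classical all_reals all_analysis.
Import Order.TTheory GRing.Theory Num.Theory numFieldNormedType.Exports.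

Set Implicit Arguments.
Unset Strict Implicit.
Unset Printing Implicit Defensive.

Local Open Scope classical_set_scope.
Local Open Scope ring_scope.

Section Algebra.
Variable R : realType.

Definition mx22 (a b c d : R) : 'M[R]_2 :=
  \matrix_(i < 2, j < 2)
    if i == 0 then (if j == 0 then a else b) else (if j == 0 then c else d).

Definition e1 : 'M[R]_2 := mx22 0 (-1) 1 0.
Definition e2 : 'M[R]_2 := mx22 0 1 1 0.
Definition e3 : 'M[R]_2 := mx22 (-1) 0 0 1.
Definition xi1 : 'M[R]_2 := mx22 0 0 1 0.
Definition xi2 : 'M[R]_2 := mx22 0 1 0 0.

Definition kk : {vspace 'M[R]_2} := <[e3]>%VS.
Definition pp : {vspace 'M[R]_2} := <<[:: e1; e2]>>%VS.

Definition SL2 : set 'M[R]_2 := [set X | \det X = 1].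
Definition sl2 : set 'M[R]_2 := [set X | \tr X = 0].

Definition Ad (F X : 'M[R]_2) : 'M[R]_2 := F *m X *m invmx F.
Definition bracket (X Y : 'M[R]_2) : 'M[R]_2 := X *m Y - Y *m X.

Definition ip (X Y : 'M[R]_2) : R := 2^-1 * \tr (X *m Y).
Definition S21 : set 'M[R]_2 := [set X | sl2 X /\ ip X X = 1].

(* The sum of the exponential series, which converges entrywise for every [X]. *)
Definition expmx (X : 'M[R]_2) : 'M[R]_2 :=
  limn (series (fun k : nat => (k`!%:R)^-1 *: X ^+ k)).

End Algebra.

Arguments e1 {R}.
Arguments e2 {R}.
Arguments e3 {R}.
Arguments xi1 {R}.
Arguments xi2 {R}.
Arguments kk {R}.
Arguments pp {R}.
Arguments SL2 {R}.
Arguments sl2 {R}.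
Arguments S21 {R}.

(* On an open subset [U] of a finite-dimensional space this is C^infty: all
   iterated directional derivatives of [f] are Frechet differentiable on [U].
   Only the germs of [f] at the points of [U] matter. *)
Definition smooth_on (R : realType) (V W : normedModType R) (U : set V)
    (f : V -> W) : Prop :=
  forall (vs : seq V) (p : V), U p ->
    differentiable (foldr (fun v g => 'D_v g) f vs) p.

Section Frames.
Variable R : realType.
Implicit Types (Omega : set (R * R)) (F nu U V : R * R -> 'M[R]_2).

Definition domain Omega : Prop := open Omega /\ connected Omega.

Definition dx (F : R * R -> 'M[R]_2) : R * R -> 'M[R]_2 := 'D_(1, 0) F.
Definition dy (F : R * R -> 'M[R]_2) : R * R -> 'M[R]_2 := 'D_(0, 1) F.

(* [F^-1 dF = U dx + V dy] on [Omega], as an identity of matrix-valued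
   1-forms evaluated on tangent vectors [v]. *)
Definition has_MC_form Omega F U V : Prop :=
  forall p v, Omega p ->
    invmx (F p) *m 'd F p v = v.1 *: U p + v.2 *: V p.

Definition smooth_SL2_map Omega F : Prop :=
  smooth_on Omega F /\ forall p, Omega p -> SL2 (F p).

(* Smooth dependence on the loop parameter is joint smoothness in
   [((x, y), lambda)], for [(x, y)] in [Omega] and [lambda != 0]. *)
Definition admissible_extended_frame Omega (Fh : R -> R * R -> 'M[R]_2)
    (A1 A2 A3 B1 B2 B3 : R * R -> R) : Prop :=
  [/\ smooth_on [set q : (R * R) * R | Omega q.1 /\ q.2 != 0]
        (fun q => Fh q.2 q.1),
      forall l p, l != 0 -> Omega p -> SL2 (Fh l p)
    & forall l, l != 0 ->
        has_MC_form Omega (Fh l)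
          (fun p => (l * A1 p) *: xi1 + A2 p *: xi2 + A3 p *: e3)
          (fun p => B1 p *: xi1 + (l^-1 * B2 p) *: xi2 + B3 p *: e3)].

(* The tension field of [nu] for a Lorentz structure with null coordinates
   [(x, y)] is, up to a factor, the component of [nu_xy] tangent to [S21], and
   in sl(2,R) that component vanishes iff [nu_xy] commutes with [nu]. *)
Definition harmonic_null Omega nu : Prop :=
  [/\ smooth_on Omega nu,
      forall p, Omega p -> S21 (nu p)
    & forall p, Omega p -> bracket (nu p) (dy (dx nu) p) = 0].

Definition frame_of Omega nu F : Prop :=
  smooth_SL2_map Omega F /\ forall p, Omega p -> nu p = Ad (F p) e3.

(* [F^-1 F_x = b0 + b1] and [F^-1 F_y = c0 + cm1] along the (direct)
   decomposition of sl(2,R) into [kk] and [pp]. *)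
Definition MC_split Omega F (b0 b1 c0 cm1 : R * R -> 'M[R]_2) : Prop :=
  forall p, Omega p ->
    [/\ b0 p \in kk /\ b1 p \in pp,
        c0 p \in kk /\ cm1 p \in pp,
        invmx (F p) *m dx F p = b0 p + b1 p
      & invmx (F p) *m dy F p = c0 p + cm1 p].

(* [E] is an extended frame of [nu], based on the frame [F] of [nu] whose
   Maurer-Cartan components are [b0], [b1], [c0], [cm1]; the values of [E] at
   the parameter 0 are irrelevant. *)
Definition extended_frame_of Omega nu F (b0 b1 c0 cm1 : R * R -> 'M[R]_2)
    (E : R -> R * R -> 'M[R]_2) : Prop :=
  [/\ frame_of Omega nu F,
      MC_split Omega F b0 b1 c0 cm1,
      forall z, z != 0 -> smooth_SL2_map Omega (E z),
      forall p, Omega p -> E 1 p = F p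
    & forall z, z != 0 ->
        has_MC_form Omega (E z)
          (fun p => b0 p + z *: b1 p) (fun p => c0 p + z^-1 *: cm1 p)].

(* Meaningful for [z != 0]. *)
Definition G_of (Fh : R -> R * R -> 'M[R]_2) (z : R) (p : R * R) : 'M[R]_2 :=
  if 0 < z then Fh (z ^+ 2) p *m expmx ((2^-1 * ln z) *: e3)
  else e3 *m Fh (z ^+ 2) p *m e3 *m expmx ((2^-1 * ln `|z|) *: e3).

End Frames.

(* Main.v *)
(* Conjugating the Maurer-Cartan form of [Fh (z^2)] by [exp ((log |z| / 2) e3)],
   and by [e3] when [z < 0], moves the loop parameter symmetrically onto the
   [pp]-components.  Harmonicity of [nu = Ad_F e3] follows from the
   zero-curvature equation for all [l]: the [l xi1] and [l^0 xi2] parts say that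
   the [pp]-component of [nu_xy], pulled back by [F], vanishes.  Two frames with
   the same Maurer-Cartan form differ by a left factor with zero derivative,
   hence constant on the connected set [Omega]. *)

Require Import Defs.
From mathcomp Require Import all_boot all_order all_algebra.
From mathcomp Require Import all_classical all_reals all_analysis.
From mathcomp Require Import ring lra.
Import Order.TTheory GRing.Theory Num.Theory numFieldNormedType.Exports.
Local Open Scope classical_set_scope.
Local Open Scope ring_scope.

Set Implicit Arguments.
Unset Strict Implicit.
Unset Printing Implicit Defensive.

(** Nothing is assumed about the regularity of the coefficients: only [Fh] is smooth. They inherit
    smoothness as entries of [F^-1 F_x] and [F^-1 F_y] at loop parameter 1. Smoothness itself is
    stated through iterated directional derivatives, so its stability under the usual operations,
    and the symmetry [F_xy = F_yx] behind the zero-curvature equation, are derived from mere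
    differentiability of those derivatives. The square in [Fh (z ^+ 2)] has this origin. Conjugating
    [M] to [D^-1 M D] with [D = diag(1/r, r)] divides the [xi1] coefficient by [r^2] and multiplies
    the [xi2] coefficient by [r^2]; starting from [z^2] and 1, both become [z] when [r^2 = z]. For
    [z < 0] no real [r] exists. Changing one sign, [D = diag(-1/r, r)] with [r^2 = |z|] has the
    required effect but determinant -1; a constant left factor [e3], also of determinant -1, brings
    the product back to [SL2] and leaves [G^-1 dG] unchanged. *)

(** * Smoothness of finite order and its stability *)

Lemma near_eq_differentiable (R : realType) (V W : normedModType R)
    (f g : V -> W) (p : V) :
  (\near p, f p = g p) -> differentiable f p -> differentiable g p.
Proof.
move=> fg df; have fgp := nbhs_singleton fg.
have [cf /eqaddoP ef] := (diff_locallyP p f).1 df.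
have eg : g \o shift p = cst (g p) + 'd f p +o_ (0 : V) id.
  apply/eqaddoP => eps eps0; have efe := ef _ eps0.
  have fg0 : \forall x \near (0 : V), f (x + p) = g (x + p).
    by move: fg; rewrite (near_shift 0 p)/= subr0.
  near=> x; have -> : (g \o shift p - (cst (g p) + 'd f p)) x =
    (f \o shift p - (cst (f p) + 'd f p)) x.
    rewrite -![(_ - _ : _ -> _) _]/(_ - _) /= -![(_ + _ : _ -> _) _]/(_ + _) /=.
    by rewrite fgp; congr (_ - _); apply/esym; near: x.
  by near: x.
apply/diff_locallyP; suff -> : 'd g p = 'd f p :> (V -> W) by split.
exact: diff_unique.
Unshelve. all: by end_near. Qed.

Section Cn_def.
Context {R : realType} {V W : normedModType R} (U : set V).

(** Counting the order allows induction where the product rule turns one derivative into a sum.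
    Derivatives of order below [n] are differentiable; nothing is said about those of order [n]. The
    innermost derivative is peeled first, in agreement with [foldr_rcons]. *)
Fixpoint Cn (n : nat) (f : V -> W) : Prop :=
  if n is m.+1 then
    (forall p, U p -> differentiable f p) /\ forall v, Cn m ('D_v f)
  else True.

End Cn_def.

Section Cn_theory.
Context {R : realType}.

Lemma smooth_onP (V W : normedModType R) (U : set V) (f : V -> W) :
  smooth_on U f <-> forall n, Cn U n f.
Proof.
split=> [sf n|Cf vs].
  elim: n f sf => //= n IH f sf; split=> [p|v]; first exact: sf [::] p.
  by apply: IH => vs p Up; have := sf (rcons vs v) p Up; rewrite foldr_rcons.
elim/last_ind: vs f Cf => [|vs v IH] f Cf p Up.
  by have [/(_ _ Up)] := Cf 1.
by rewrite foldr_rcons; apply: IH => // n; have [_] := Cf n.+1; exact.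
Qed.

Lemma smooth_on_differentiable (V W : normedModType R) (U : set V)
    (f : V -> W) p : smooth_on U f -> U p -> differentiable f p.
Proof. by move=> sf; exact: sf [::] p. Qed.

Lemma smooth_on_derive (V W : normedModType R) (U : set V) (f : V -> W) v :
  smooth_on U f -> smooth_on U ('D_v f).
Proof.
by move=> sf vs p Up; have := sf (rcons vs v) p Up; rewrite foldr_rcons.
Qed.

(** Differentiation rules give identities only on [U], where the maps are differentiable. Openness
    makes them equalities of germs, which pass to the next derivative. *)
Lemma Cn_ext (V W : normedModType R) (U : set V) n (f g : V -> W) : open U ->
  (forall p, U p -> f p = g p) -> Cn U n f -> Cn U n g.
Proof.
move=> oU; elim: n f g => //= n IH f g fg [df Cf].
have nfg p : U p -> \near p, f p = g p.
  move=> Up; have : nbhs p U by exact: open_nbhs_nbhs.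
  by apply: filterS => q; exact: fg.
split=> [p Up|v]; first exact: near_eq_differentiable (nfg p Up) (df p Up).
by apply: IH (Cf v) => p Up; exact/near_eq_derive/nfg.
Qed.

Lemma smooth_on_ext (V W : normedModType R) (U : set V) (f g : V -> W) :
  open U -> (forall p, U p -> f p = g p) -> smooth_on U f -> smooth_on U g.
Proof.
by move=> oU fg /smooth_onP Cf; apply/smooth_onP => n; exact: Cn_ext (Cf n).
Qed.

Lemma Cn_pred (V W : normedModType R) (U : set V) n (f : V -> W) :
  Cn U n.+1 f -> Cn U n f.
Proof.
elim: n f => // n IH f [df Cf]; split=> // v; exact/IH/Cf.
Qed.

Lemma Cn_cst (V W : normedModType R) (U : set V) n (a : W) : Cn U n (cst a).
Proof.
elim: n a => //= n IH a; split=> [p _|v]; first exact: differentiable_cst.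
have -> : 'D_v (cst a) = cst (0 : W) :> (V -> W).
  by apply/funext => p; rewrite derive_cst.
exact: IH.
Qed.

Lemma CnD (V W : normedModType R) (U : set V) n (f g : V -> W) : open U ->
  Cn U n f -> Cn U n g -> Cn U n (fun p => f p + g p).
Proof.
move=> oU; elim: n f g => //= n IH f g [df Cf] [dg Cg]; split=> [p Up|v].
  by apply: differentiableD; [exact: df|exact: dg].
apply: Cn_ext (IH _ _ (Cf v) (Cg v)) => // p Up.
by rewrite -deriveD//; apply: diff_derivable; [exact: df|exact: dg].
Qed.

Lemma CnM (V : normedModType R) (U : set V) n (f g : V -> R) : open U ->
  Cn U n f -> Cn U n g -> Cn U n (fun p => f p * g p).
Proof.
move=> oU; elim: n f g => // n IH f g Cf Cg.
have [df Df] := Cf; have [dg Dg] := Cg; split=> [p Up|v].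
  by apply: differentiableM; [exact: df|exact: dg].
apply: (@Cn_ext _ _ _ _ (fun p => f p * 'D_v g p + g p * 'D_v f p)) => //.
  move=> p Up; rewrite (@deriveM _ _ f g)//; apply: diff_derivable.
  - exact: df.
  - exact: dg.
(* In each term one factor has lost a derivative; [Cn_pred] lowers the other to the same order. *)
apply: CnD => //; first exact: IH (Cn_pred Cf) (Dg v).
exact: IH (Cn_pred Cg) (Df v).
Qed.

Lemma derive_comp_affine (V V' W : normedModType R) (f : V' -> W)
    (i : V -> V') x v v' : (forall h : R, i (h *: v + x) = h *: v' + i x) ->
  'D_v (fun y => f (i y)) x = 'D_v' f (i x).
Proof.
move=> hi; rewrite /derive.
set q1 := (fun h : R => _); set q2 := (fun h : R => h^-1 *: (_ - f (i x))).
by suff -> : q1 = q2 by []; apply/funext => h; rewrite /q1 /q2 /= hi.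
Qed.

(** Here [j] is the linear part of [i]. A derivative of the composite is again a composite with the
    same [i], in a direction independent of the point, so the induction closes. It serves to freeze
    the loop parameter. *)
Lemma Cn_comp_affine (V V' W : normedModType R) (U : set V') n (f : V' -> W)
    (i j : V -> V') :
  (forall x, differentiable i x) ->
  (forall x v (h : R), i (h *: v + x) = h *: j v + i x) ->
  Cn U n f -> Cn (i @^-1` U) n (fun x => f (i x)).
Proof.
move=> di hi; elim: n f => //= n IH f [df Cf]; split=> [p Up|v].
  by apply: differentiable_comp => //; exact: df.
have -> : 'D_v (fun x => f (i x)) = (fun x => 'D_(j v) f (i x)).
  by apply/funext => x; rewrite (derive_comp_affine f (hi x v)).
exact: IH (Cf (j v)).
Qed.

Lemma Cn_coord (V : normedModType R) (U : set V) n a b (F : V -> 'M[R]_(a, b))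
    i j : open U -> Cn U n F -> Cn U n (fun p => F p i j).
Proof.
move=> oU; elim: n F => //= n IH F [dF CF]; split=> [p Up|v].
  exact: (differentiable_comp (dF p Up) (differentiable_coord _ i j)).
apply: Cn_ext (IH _ (CF v)) => // p Up.
by rewrite derive_mx ?mxE//; exact/diff_derivable/dF.
Qed.

Lemma Cn_scalel (V W : normedModType R) (U : set V) n (f : V -> R) (w : W) :
  open U -> Cn U n f -> Cn U n (fun p => f p *: w).
Proof.
move=> oU; elim: n f => //= n IH f [df Cf]; split=> [p Up|v].
  exact: (differentiableZl w (df p Up)).
apply: Cn_ext (IH _ (Cf v)) => // p Up.
have dp := df p Up.
by rewrite !deriveE ?diffZl//; exact: differentiableZl.
Qed.

Lemma Cn_sum (V W : normedModType R) (U : set V) n (I : Type) (s : seq I)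
    (f : I -> V -> W) : open U -> (forall i, Cn U n (f i)) ->
  Cn U n (fun p => \sum_(i <- s) f i p).
Proof.
move=> oU Cf; elim: s => [|i s IH].
  by apply: Cn_ext (Cn_cst U n 0) => // p _; rewrite big_nil.
by apply: Cn_ext (CnD oU (Cf i) IH) => // p _; rewrite big_cons.
Qed.

Lemma Cn_mxP (V : normedModType R) (U : set V) n a b (F : V -> 'M[R]_(a, b)) :
  open U -> (forall i j, Cn U n (fun p => F p i j)) -> Cn U n F.
Proof.
move=> oU CF.
apply: (@Cn_ext _ _ _ _ (fun p => \sum_i \sum_j F p i j *: delta_mx i j)) => //.
  by move=> p _; rewrite -matrix_sum_delta.
by do 2 (apply: Cn_sum => // ?); exact: Cn_scalel.
Qed.

Lemma smooth_on_cst (V W : normedModType R) (U : set V) (a : W) :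
  smooth_on U (fun=> a).
Proof. by apply/smooth_onP => n; exact: Cn_cst. Qed.

Lemma smooth_on_mulmx (V : normedModType R) (U : set V) a b c
    (F : V -> 'M[R]_(a, b)) (G : V -> 'M[R]_(b, c)) : open U ->
  smooth_on U F -> smooth_on U G -> smooth_on U (fun p => F p *m G p).
Proof.
move=> oU /smooth_onP CF /smooth_onP CG; apply/smooth_onP => n.
apply: Cn_mxP => // i j.
apply: (@Cn_ext _ _ _ _ (fun p => \sum_k F p i k * G p k j)) => //.
  by move=> p _; rewrite mxE.
by apply: Cn_sum => // k; apply: CnM => //; exact: Cn_coord.
Qed.

Lemma smooth_on_trmx (V : normedModType R) (U : set V) a b
    (F : V -> 'M[R]_(a, b)) : open U ->
  smooth_on U F -> smooth_on U (fun p => (F p)^T).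
Proof.
move=> oU /smooth_onP CF; apply/smooth_onP => n.
apply: Cn_mxP => // i j.
by apply: Cn_ext (Cn_coord j i oU (CF n)) => // p _; rewrite mxE.
Qed.

End Cn_theory.

(** * Mean value theorem, symmetry of second derivatives, vanishing derivatives *)

Section Mean_value.
Context {R : realType} {V : normedModType R}.
Implicit Types (f : V -> R) (U : set V).

Lemma MVT_line f p v (h : R) : 0 < h ->
  (forall t, 0 <= t <= h -> differentiable f (p + t *: v)) ->
  exists2 c, 0 <= c <= h & f (p + h *: v) - f p = h * 'D_v f (p + c *: v).
Proof.
move=> h0 df; pose g t := f (p + t *: v).
have dg t : 0 <= t <= h -> differentiable g t.
  move=> th; rewrite -[g]/(f \o (fun t => p + t *: v)).
  by apply: differentiable_comp => //; exact: df.
have [t| |c] := @MVT R g (fun t => 'D_v f (p + t *: v)) 0 h h0.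
- rewrite in_itv/= => /andP[t0 th].
  apply: DeriveDef.
    by apply/diff_derivable/dg; rewrite !ltW.
  apply: (derive_comp_affine f) => s.
  by rewrite scalerDl [s *: 1]mulr1 addrCA.
- apply: continuous_in_subspaceT => t; rewrite inE/= in_itv/= => th.
  exact/differentiable_continuous/dg.
rewrite in_itv/= => /andP[c0 ch]; rewrite /g scale0r addr0 subr0 mulrC => ->.
by exists c => //; rewrite !ltW.
Qed.

(** Mean value theorem twice: along [u] for [f (q + h *: v) - f q] as a function of [q], then along
    [v] for ['D_u f]. *)
Lemma second_difference U f p u v (h : R) : 0 < h ->
  (forall q, U q -> differentiable f q /\ differentiable ('D_u f) q) ->
  (forall s t, 0 <= s <= h -> 0 <= t <= h -> U (p + s *: u + t *: v)) ->
  exists s t, [/\ 0 <= s <= h, 0 <= t <= h &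
    f (p + h *: u + h *: v) - f (p + h *: u) - (f (p + h *: v) - f p) =
    h * (h * 'D_v ('D_u f) (p + s *: u + t *: v))].
Proof.
move=> h0 df Uh; have hh : 0 <= h <= h by rewrite lexx ltW.
have h00 : 0 <= (0 : R) <= h by rewrite lexx ltW.
have dfh s : 0 <= s <= h ->
    differentiable (fun q => f (q + h *: v)) (p + s *: u).
  move=> sh; rewrite (_ : (fun q => _) = f \o (fun q => q + h *: v)) //.
  by apply: differentiable_comp => //; exact: (df _ (Uh _ _ sh hh)).1.
have df0 s : 0 <= s <= h -> differentiable f (p + s *: u).
  by move=> sh; have [] := df _ (Uh _ _ sh h00); rewrite scale0r addr0.
have [s sh es] := @MVT_line (fun q => f (q + h *: v) - f q) p u h h0
  (fun s sh => differentiableB (dfh s sh) (df0 s sh)).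
have [t th et] := @MVT_line ('D_u f) (p + s *: u) v h h0
  (fun t th => (df _ (Uh s t sh th)).2).
exists s, t; split=> //; rewrite es; congr (_ * _); rewrite -et.
rewrite (@deriveB _ _ _ (fun q => f (q + h *: v)) f).
- rewrite (@derive_comp_affine _ _ _ _ f (fun q => q + h *: v) _ u u)// => k.
  by rewrite -!addrA.
- exact/diff_derivable/dfh.
- exact/diff_derivable/df0.
Qed.

(** The second difference is symmetric in [u] and [v], so each mixed derivative, at its own
    intermediate point, equals the same quantity divided by [h^2]. *)
Lemma mixed_derive_near U f u v p : open U -> U p ->
  (forall q, U q -> [/\ differentiable f q, differentiable ('D_u f) q
     & differentiable ('D_v f) q]) ->
  forall A, nbhs p A -> exists q q',
    [/\ A q, A q' & 'D_v ('D_u f) q = 'D_u ('D_v f) q'].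
Proof.
move=> oU Up df A nA; have nU : nbhs p U by exact: open_nbhs_nbhs.
have /nbhs_ballP[r /= r0 near_p] : nbhs p (A `&` U) by exact: filterI.
(* This size keeps the parallelogram spanned by [h *: u] and [h *: v] inside the ball of radius [r];
   the added 1 makes the denominator positive and the bound strict. *)
pose h := r / (`|u| + `|v| + 1).
have uv1 : 0 < `|u| + `|v| + 1 by rewrite ltr_wpDl// addr_ge0.
have h0 : 0 < h by rewrite divr_gt0.
have AU s t : 0 <= s <= h -> 0 <= t <= h -> (A `&` U) (p + s *: u + t *: v).
  move=> /andP[s0 sh] /andP[t0 th]; apply: near_p.
  rewrite -ball_normE /ball_/=.
  rewrite -addrA opprD addNKr normrN (le_lt_trans (ler_normD _ _))//.
  rewrite !normrZ !ger0_norm//.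
  have -> : r = h * (`|u| + `|v| + 1) by rewrite /h divfK// gt_eqF.
  by rewrite !mulrDr mulr1 ltr_pwDr// lerD// ler_wpM2r.
have [s [t [sh th est]]] := @second_difference U f p u v h h0
  (fun q Uq => let: And3 d1 d2 _ := df q Uq in conj d1 d2)
  (fun s t sh th => (AU s t sh th).2).
have swap s' t' : p + s' *: v + t' *: u = p + t' *: u + s' *: v.
  by rewrite addrAC.
have [s' [t' [sh' th' est']]] := @second_difference U f p v u h h0
  (fun q Uq => let: And3 d1 _ d2 := df q Uq in conj d1 d2)
  (fun s t sh th => eq_ind_r U (AU t s th sh).2 (swap s t)).
exists (p + s *: u + t *: v), (p + t' *: u + s' *: v); split.
- exact: (AU s t sh th).1.
- exact: (AU t' s' th' sh').1.
rewrite swap in est'; rewrite swap in est'.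
apply: (mulfI (lt0r_neq0 h0)); apply: (mulfI (lt0r_neq0 h0)).
rewrite -[LHS]est -[RHS]est'.
by move: (f (_ + _)) (f (_ + _)) (f (_ + _)) (f p) => a b c d; ring.
Qed.

Lemma eq_of_near (a b : V -> R) p :
  {for p, continuous a} -> {for p, continuous b} ->
  (forall A, nbhs p A -> exists q q', [/\ A q, A q' & a q = b q']) ->
  a p = b p.
Proof.
move=> ca cb ab; apply/eqP; rewrite -subr_eq0 -normr_le0.
apply/ler_addgt0Pr => /= e e0; rewrite add0r.
have e20 : 0 < e / 2 by rewrite divr_gt0.
move/cvgrPdist_lt : ca => /(_ _ e20) na.
move/cvgrPdist_lt : cb => /(_ _ e20) nb.
have [q [q' [[/= aq _] [/= _ bq] abq]]] := ab _ (filterI na nb).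
rewrite (splitr e) -(subrKA (a q)) (le_trans (ler_normD _ _))// lerD//.
  exact: ltW.
by rewrite abq distrC ltW.
Qed.

Lemma derive_sym U f u v p : open U -> U p ->
  (forall q, U q -> [/\ differentiable f q, differentiable ('D_u f) q
     & differentiable ('D_v f) q]) ->
  {for p, continuous ('D_v ('D_u f))} -> {for p, continuous ('D_u ('D_v f))} ->
  'D_v ('D_u f) p = 'D_u ('D_v f) p.
Proof.
move=> oU Up df ca cb; apply: (eq_of_near ca cb).
exact: mixed_derive_near oU Up df.
Qed.

(** By the mean value theorem along radii [f] is constant on small balls, so its level set through
    [p] is open and closed in [U]. *)
Lemma derive0_connected U f : open U -> connected U ->
  (forall p, U p -> differentiable f p) ->
  (forall p v, U p -> 'D_v f p = 0) -> forall p q, U p -> U q -> f p = f q.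
Proof.
move=> oU cU df Df.
have loc x : U x -> \forall y \near x, U y /\ f y = f x.
  move=> Ux; have /nbhs_ballP[r /= r0 xr] : nbhs x U by exact: open_nbhs_nbhs.
  apply/nbhs_ballP; exists r => //= y xy; split; first exact: xr.
  have Ut t : 0 <= t <= 1 -> U (x + t *: (y - x)).
    move=> /andP[t0 t1]; apply: xr; move: xy.
    rewrite -!ball_normE /ball_/= opprD addNKr normrN normrZ ger0_norm//.
    by rewrite distrC; apply: le_lt_trans; rewrite ler_piMl.
  have [c c01] := @MVT_line f x (y - x) 1 ltr01 (fun t t01 => df _ (Ut t t01)).
  rewrite scale1r subrKC Df ?mulr0; last exact: Ut.
  by move/subr0_eq.
move=> p q Up Uq.
suff : U `&` [set x | f x = f p] = U.
  by move=> /seteqP[_ /(_ q Uq)[]].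
apply: cU.
- by exists p.
- exists (U `&` [set x | f x = f p]); last by rewrite setIA setIid.
  rewrite openE => x [Ux fx]; rewrite /interior.
  by apply: filterS (loc x Ux) => y [Uy fy]; split=> //=; rewrite fy.
- exists (~` (U `&` [set x | f x != f p])).
    apply: open_closedC; rewrite openE => x [Ux fx]; rewrite /interior.
    by apply: filterS (loc x Ux) => y [Uy fy]; split=> //=; rewrite fy.
  apply/seteqP; split=> x [Ux]/=.
    by move=> fx; split=> // -[_]; rewrite fx eqxx.
  by move=> nfx; split=> //; apply: contrapT => /eqP fx; apply: nfx.
Qed.

End Mean_value.

(** * Derivatives of matrix-valued maps *)

Section Derive_mx.
Context {R : realType} {V : normedModType R}.

Lemma is_derive_mxP a b (F : V -> 'M[R]_(a, b)) p v (D : 'M[R]_(a, b)) :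
  is_derive p v F D <-> forall i j, is_derive p v (fun q => F q i j) (D i j).
Proof.
split=> [[dF <-] i j|dF].
  apply: DeriveDef; first exact: (derivable_mxP F p v).1.
  by rewrite derive_mx// mxE.
have dFp : derivable F p v by apply/derivable_mxP => i j; have [] := dF i j.
apply: DeriveDef => //; rewrite derive_mx//; apply/matrixP => i j.
by rewrite mxE; have [] := dF i j.
Qed.

Lemma is_derive_mulmx a b c (F : V -> 'M[R]_(a, b)) (G : V -> 'M[R]_(b, c))
    p v dF dG : is_derive p v F dF -> is_derive p v G dG ->
  is_derive p v (fun q => F q *m G q) (dF *m G p + F p *m dG).
Proof.
move=> /is_derive_mxP DF /is_derive_mxP DG; apply/is_derive_mxP => i j.
rewrite (_ : (fun q => _) = \sum_k (fun q => F q i k * G q k j)); last first.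
  by apply/funext => q; rewrite mxE fct_sumE.
rewrite !mxE -big_split/=.
apply: is_derive_sum => k.
have /is_derive_eq := is_deriveM (DF i k) (DG k j); apply.
by rewrite addrC; congr (_ + _); exact: mulrC.
Qed.

Lemma is_derive_mulmxl a b c (A : 'M[R]_(a, b)) (F : V -> 'M[R]_(b, c)) p v dF :
  is_derive p v F dF -> is_derive p v (fun q => A *m F q) (A *m dF).
Proof.
move=> DF; apply: is_derive_eq.
  exact: is_derive_mulmx (is_derive_cst A p v) DF.
by rewrite mul0mx add0r.
Qed.

Lemma is_derive_mulmxr a b c (F : V -> 'M[R]_(a, b)) (A : 'M[R]_(b, c)) p v dF :
  is_derive p v F dF -> is_derive p v (fun q => F q *m A) (dF *m A).
Proof.
move=> DF; apply: is_derive_eq.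
  exact: is_derive_mulmx DF (is_derive_cst A p v).
by rewrite mulmx0 addr0.
Qed.

Lemma is_derive_trmx a b (F : V -> 'M[R]_(a, b)) p v dF :
  is_derive p v F dF -> is_derive p v (fun q => (F q)^T) dF^T.
Proof.
move=> /is_derive_mxP DF; apply/is_derive_mxP => i j; rewrite mxE.
by under eq_fun do rewrite mxE; exact: DF.
Qed.

Lemma derive_sym_mx a b (U : set V) (F : V -> 'M[R]_(a, b)) u v p :
  open U -> U p -> smooth_on U F -> 'D_v ('D_u F) p = 'D_u ('D_v F) p.
Proof.
move=> oU Up sF; apply/matrixP => i j.
have sij : smooth_on U (fun q => F q i j).
  apply/smooth_onP => n; apply: Cn_coord => //.
  exact: (smooth_onP _ _).1.
have nU (q : V) : U q -> nbhs q U by move=> Uq; exact: open_nbhs_nbhs.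
(* Taking entries commutes with ['D_w] only where [F] is differentiable, that is on [U]; equality
   near [p] suffices for the outer derivative. *)
have Dij w w' : ('D_w' ('D_w F) p) i j = 'D_w' ('D_w (fun q => F q i j)) p.
  rewrite derive_mx ?mxE; last first.
    exact/diff_derivable/(smooth_on_differentiable (smooth_on_derive w sF)).
  apply: near_eq_derive; apply: filterS (nU p Up) => q Uq.
  rewrite derive_mx ?mxE//.
  exact/diff_derivable/(smooth_on_differentiable sF).
apply: etrans (Dij u v) (etrans _ (esym (Dij v u))).
apply: (@derive_sym _ _ U (fun q => F q i j) u v p oU Up).
- move=> q Uq; split; first exact: smooth_on_differentiable Uq.
  + exact: smooth_on_differentiable (smooth_on_derive u sij) Uq.
  + exact: smooth_on_differentiable (smooth_on_derive v sij) Uq.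
- apply/differentiable_continuous/(smooth_on_differentiable _ Up).
  exact/smooth_on_derive/smooth_on_derive.
- apply/differentiable_continuous/(smooth_on_differentiable _ Up).
  exact/smooth_on_derive/smooth_on_derive.
Qed.

Lemma derive0_connected_mx a b (U : set V) (F : V -> 'M[R]_(a, b)) :
  open U -> connected U -> (forall p, U p -> differentiable F p) ->
  (forall p v, U p -> 'D_v F p = 0) -> forall p q, U p -> U q -> F p = F q.
Proof.
move=> oU cU dF DF p q Up Uq; apply/matrixP => i j.
apply: (derive0_connected (f := fun q => F q i j) oU cU) => // x.
  by move=> Ux; exact: differentiable_comp (dF x Ux) (differentiable_coord _ i j).
move=> v Ux; have := DF x v Ux.
rewrite derive_mx; last exact/diff_derivable/dF.
by move=> /matrixP/(_ i j); rewrite !mxE.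
Qed.

End Derive_mx.

(** * Two-by-two matrices and their adjugates *)

Section Matrix22.
Context {R : realType}.
Implicit Types M N : 'M[R]_2.

Lemma mx22_eta M : M = mx22 (M 0 0) (M 0 1) (M 1 0) (M 1 1).
Proof.
apply/matrixP => -[[|[|//]] hi] [[|[|//]] hj]; rewrite mxE/=;
  by congr (M _ _); exact: val_inj.
Qed.

Lemma mx22D (a b c d a' b' c' d' : R) :
  mx22 a b c d + mx22 a' b' c' d' = mx22 (a + a') (b + b') (c + c') (d + d').
Proof. by rewrite [LHS]mx22_eta !mxE. Qed.

Lemma mx22N (a b c d : R) : - mx22 a b c d = mx22 (- a) (- b) (- c) (- d).
Proof. by rewrite [LHS]mx22_eta !mxE. Qed.

Lemma mx22Z (k a b c d : R) :
  k *: mx22 a b c d = mx22 (k * a) (k * b) (k * c) (k * d).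
Proof. by rewrite [LHS]mx22_eta !mxE. Qed.

Lemma mx22M (a b c d a' b' c' d' : R) :
  mx22 a b c d *m mx22 a' b' c' d' =
  mx22 (a * a' + b * c') (a * b' + b * d') (c * a' + d * c') (c * b' + d * d').
Proof. by rewrite [LHS]mx22_eta !mxE !big_ord_recl !big_ord0 !mxE/= !addr0. Qed.

Lemma mx22T (a b c d : R) : (mx22 a b c d)^T = mx22 a c b d.
Proof. by rewrite [LHS]mx22_eta !mxE. Qed.

Lemma mx22_1 : 1%:M = mx22 1 0 0 1 :> 'M[R]_2.
Proof. by rewrite [LHS]mx22_eta !mxE. Qed.

Lemma mx22_inj (a b c d a' b' c' d' : R) :
  mx22 a b c d = mx22 a' b' c' d' -> [/\ a = a', b = b', c = c' & d = d'].
Proof.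
by move=> /matrixP E; split; [have := E 0 0|have := E 0 1|have := E 1 0|
  have := E 1 1]; rewrite !mxE.
Qed.

Lemma det22 (a b c d : R) : \det (mx22 a b c d) = a * d - b * c.
Proof.
rewrite (expand_det_row _ 0) !big_ord_recl big_ord0 /cofactor !det_mx11 !mxE/=.
by rewrite /bump/=; ring.
Qed.

Lemma tr22 (a b c d : R) : \tr (mx22 a b c d) = a + d.
Proof. by rewrite /mxtrace !big_ord_recl big_ord0 !mxE/= addr0. Qed.

Definition mx22E := (mx22D, mx22N, mx22Z, mx22M, mx22T).

End Matrix22.

Section Adjugate22.
Context {R : realType}.
Implicit Types M N : 'M[R]_2.

Lemma e1E : e1 = mx22 0 (-1) 1 0 :> 'M[R]_2. Proof. by []. Qed.

(** The adjugate: it agrees with [invmx] on [SL2], but is linear in the entries and so easy to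
    differentiate. *)
Definition adj2 M : 'M[R]_2 := mx22 (M 1 1) (- M 0 1) (- M 1 0) (M 0 0).

Lemma adj2E (a b c d : R) : adj2 (mx22 a b c d) = mx22 d (- b) (- c) a.
Proof. by rewrite /adj2 !mxE. Qed.

(** [e1] is a quarter turn and [- e1] its inverse. The formula reduces the smoothness and the
    derivative of [adj2] to transposition and products with constants. *)
Lemma adj2_trmx M : adj2 M = e1 *m M^T *m (- e1).
Proof.
by rewrite (mx22_eta M) adj2E e1E !mx22E; congr mx22; ring.
Qed.

Lemma adj2M M N : adj2 (M *m N) = adj2 N *m adj2 M.
Proof.
by rewrite (mx22_eta M) (mx22_eta N) mx22M !adj2E mx22M; congr mx22; ring.
Qed.

Lemma adj2_tr0 M : \tr M = 0 -> adj2 M = - M.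
Proof.
rewrite (mx22_eta M) tr22 adj2E mx22N => /eqP; rewrite addr_eq0 => /eqP ->.
by rewrite opprK.
Qed.

Lemma det_adj2 M : \det (adj2 M) = \det M.
Proof. by rewrite (mx22_eta M) adj2E !det22; ring. Qed.

Lemma mulmx_adj2 M : SL2 M -> M *m adj2 M = 1%:M.
Proof.
rewrite /SL2/= (mx22_eta M) det22 adj2E mx22M mx22_1 => M1.
by congr mx22; rewrite -?M1; ring.
Qed.

Lemma mul_adj2mx M : SL2 M -> adj2 M *m M = 1%:M.
Proof. by move=> /mulmx_adj2/mulmx1C. Qed.

Lemma invmx_adj2 M : SL2 M -> invmx M = adj2 M.
Proof.
move=> M1; have uM : M \in unitmx by rewrite unitmxE M1 unitr1.
by rewrite -[LHS]mulmx1 -(mulmx_adj2 M1) mulKmx.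
Qed.

Lemma smooth_on_adj2 (V : normedModType R) (U : set V) (F : V -> 'M[R]_2) :
  open U -> smooth_on U F -> smooth_on U (fun p => adj2 (F p)).
Proof.
move=> oU sF; under eq_fun do rewrite adj2_trmx.
apply: smooth_on_mulmx => //; last exact: smooth_on_cst.
apply: smooth_on_mulmx => //; first exact: smooth_on_cst.
exact: smooth_on_trmx.
Qed.

Lemma is_derive_adj2 (V : normedModType R) (F : V -> 'M[R]_2) p v dF :
  is_derive p v F dF -> is_derive p v (fun q => adj2 (F q)) (adj2 dF).
Proof.
move=> DF; under eq_fun do rewrite adj2_trmx.
by rewrite adj2_trmx; apply/is_derive_mulmxr/is_derive_mulmxl/is_derive_trmx.
Qed.

Lemma is_derive_mx22 (V : normedModType R) (a b c d : V -> R) p v a' b' c' d' :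
  is_derive p v a a' -> is_derive p v b b' -> is_derive p v c c' ->
  is_derive p v d d' ->
  is_derive p v (fun q => mx22 (a q) (b q) (c q) (d q)) (mx22 a' b' c' d').
Proof.
move=> Da Db Dc Dd; apply/is_derive_mxP => i j; rewrite mxE.
under eq_fun do rewrite mxE.
by case: (i == 0); case: (j == 0).
Qed.

(* For [SL2]-valued [G] with [G^-1 dG = W], [adj2 G] is [G^-1], whose
   derivative is [- W G^-1]. *)
Lemma is_derive_conj (V : normedModType R) (E G K : V -> 'M[R]_2) p v W K' :
  \tr W = 0 ->
  is_derive p v E (E p *m W) -> is_derive p v G (G p *m W) ->
  is_derive p v K K' ->
  is_derive p v (fun q => E q *m K q *m adj2 (G q))
    (E p *m (W *m K p - K p *m W + K') *m adj2 (G p)).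
Proof.
move=> W0 DE DG DK.
have /is_derive_eq := is_derive_mulmx (is_derive_mulmx DE DK) (is_derive_adj2 DG).
apply; rewrite adj2M (adj2_tr0 W0) mulNmx mulmxN mulmxA -mulmxBl.
congr (_ *m _); rewrite !mulmxDr mulmxN !mulmxA.
by rewrite addrAC.
Qed.

End Adjugate22.

(** * The exponential of multiples of [e3] and the change of loop parameter *)

Section Exponential.
Context {R : realType}.

Lemma e3E : e3 = mx22 (-1) 0 0 1 :> 'M[R]_2. Proof. by []. Qed.
Lemma xi1E : xi1 = mx22 0 0 1 0 :> 'M[R]_2. Proof. by []. Qed.
Lemma xi2E : xi2 = mx22 0 1 0 0 :> 'M[R]_2. Proof. by []. Qed.

(** As [e3] is diagonal, the matrix series splits into two scalar exponential series times constant
    matrices. *)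
Lemma expmx_e3 (t : R) : expmx (t *: e3) = mx22 (expR (- t)) 0 0 (expR t).
Proof.
have powE k : (t *: e3) ^+ k = mx22 ((- t) ^+ k) 0 0 (t ^+ k) :> 'M[R]_2.
  elim: k => [|k IH]; first by rewrite !expr0 -mx22_1.
  by rewrite exprS IH e3E -mulmxE !mx22E !exprS; congr mx22; ring.
have serE : series (fun k => (k`!%:R)^-1 *: (t *: e3) ^+ k : 'M[R]_2) =
    (fun n => series (exp_coeff (- t)) n *: mx22 1 0 0 0
      + series (exp_coeff t) n *: mx22 0 0 0 1).
  apply/funext => n; rewrite /series/= !scaler_suml -big_split/=.
  apply: eq_bigr => k _; rewrite powE /exp_coeff/= !mx22E.
  by congr mx22; ring.
rewrite /expmx serE; apply: cvg_lim => //.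
have -> : mx22 (expR (- t)) 0 0 (expR t) =
    expR (- t) *: mx22 1 0 0 0 + expR t *: mx22 0 0 0 1 :> 'M[R]_2.
  by rewrite !mx22E; congr mx22; ring.
by apply: cvgD; apply: cvgZr_tmp; exact: is_cvg_series_exp_coeff.
Qed.

(* A common form of the right factor of [G_of] for both signs of the
   parameter [z = s r^2]. *)
Definition twist (s r : R) : 'M[R]_2 := mx22 (s / r) 0 0 r.

(** Written without inverses. Passing [twist s r] to the left divides the [xi1] coefficient by [z]
    and multiplies the [xi2] coefficient by [z], because [s^2 = 1]. *)
Lemma twist_intertwine (s r a b c : R) : s = 1 \/ s = -1 -> r != 0 ->
  let z := s * r ^+ 2 in
  ((z ^+ 2 * a) *: xi1 + b *: xi2 + c *: e3) *m twist s r =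
    twist s r *m (c *: e3 + z *: (a *: xi1 + b *: xi2)) /\
  (a *: xi1 + ((z ^+ 2)^-1 * b) *: xi2 + c *: e3) *m twist s r =
    twist s r *m (c *: e3 + z^-1 *: (a *: xi1 + b *: xi2)).
Proof.
move=> sE r0 z; rewrite /z e3E xi1E xi2E /twist !mx22E.
by case: sE => ->; split; congr mx22; field.
Qed.

(** [P] is the identity or [e3], according to the sign of [z]; its determinant [s] cancels that of
    [twist s r]. For [z < 0] the inner [e3] is absorbed into the twist. *)
Lemma G_of_factor (Fh : R -> R * R -> 'M[R]_2) (z : R) : z != 0 ->
  exists P s r, [/\ s = 1 \/ s = -1, r != 0, z = s * r ^+ 2,
    \det P = s & forall p, G_of Fh z p = P *m Fh (z ^+ 2) p *m twist s r].
Proof.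
move=> z0; have r0 : expR (2^-1 * ln `|z|) != 0 by rewrite gt_eqF// expR_gt0.
have r2 : expR (2^-1 * ln `|z|) ^+ 2 = `|z|.
  rewrite -expRM_natr mulrAC mulVf ?mul1r ?lnK ?posrE ?normr_gt0//.
move: r0 r2; rewrite /G_of; case: ltgtP z0 => //[zgt|zlt] _ r0 r2.
  rewrite gtr0_norm// in r0 r2 *.
  exists 1%:M, 1, (expR (2^-1 * ln z)); split=> //; first by left.
  - by rewrite r2 mul1r.
  - by rewrite det1.
  by move=> p; rewrite mul1mx expmx_e3 /twist expRN div1r.
exists e3, (-1), (expR (2^-1 * ln `|z|)); split=> //; first by right.
- by rewrite r2 ltr0_norm//; ring.
- by rewrite e3E det22; ring.
move=> p; rewrite -!mulmxA; congr (_ *m (_ *m _)).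
by rewrite expmx_e3 e3E mx22M expRN; congr mx22; ring.
Qed.

End Exponential.

(** * Maurer-Cartan forms: regularity, flatness, uniqueness *)

Section Maurer_Cartan.
Context {R : realType}.
Implicit Types (Omega : set (R * R)) (F U V : R * R -> 'M[R]_2).

Lemma SL2M (M N : 'M[R]_2) : SL2 M -> SL2 N -> SL2 (M *m N).
Proof. by rewrite /SL2/= det_mulmx => -> ->; rewrite mulr1. Qed.

Lemma mulmx_invmx_SL2 (M N : 'M[R]_2) : SL2 M -> M *m (invmx M *m N) = N.
Proof.
by move=> M1; rewrite (invmx_adj2 M1) mulmxA (mulmx_adj2 M1) mul1mx.
Qed.

Lemma adj2_mulKmx (M N : 'M[R]_2) : SL2 M -> adj2 M *m (M *m N) = N.
Proof. by move=> M1; rewrite mulmxA mul_adj2mx// mul1mx. Qed.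

Lemma MC_is_derive Omega F U V p v : smooth_SL2_map Omega F ->
  has_MC_form Omega F U V -> Omega p ->
  is_derive p v F (F p *m (v.1 *: U p + v.2 *: V p)).
Proof.
move=> [sF F1] MC Op; have dF := smooth_on_differentiable sF Op.
apply: DeriveDef; first exact: diff_derivable.
by rewrite deriveE// -(MC p v Op) mulmx_invmx_SL2//; exact: F1.
Qed.

Lemma is_derive_MC Omega F U V : smooth_SL2_map Omega F ->
  (forall p v, Omega p -> is_derive p v F (F p *m (v.1 *: U p + v.2 *: V p))) ->
  has_MC_form Omega F U V.
Proof.
move=> [sF F1] DF p v Op; have dF := smooth_on_differentiable sF Op.
rewrite -deriveE// (@derive_val _ _ _ _ _ _ _ (DF p v Op)) mulmxA.
by rewrite (invmx_adj2 (F1 p Op)) (mul_adj2mx (F1 p Op)) mul1mx.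
Qed.

Lemma MC_dx Omega F U V p : smooth_SL2_map Omega F ->
  has_MC_form Omega F U V -> Omega p -> dx F p = F p *m U p.
Proof.
move=> sF MC Op; have [_] := MC_is_derive (1, 0) sF MC Op.
by rewrite /= scale1r scale0r addr0.
Qed.

Lemma MC_dy Omega F U V p : smooth_SL2_map Omega F ->
  has_MC_form Omega F U V -> Omega p -> dy F p = F p *m V p.
Proof.
move=> sF MC Op; have [_] := MC_is_derive (0, 1) sF MC Op.
by rewrite /= scale1r scale0r add0r.
Qed.

Lemma smooth_on_MC Omega F U V : open Omega -> smooth_SL2_map Omega F ->
  has_MC_form Omega F U V -> smooth_on Omega U /\ smooth_on Omega V.
Proof.
move=> oO sF MC; have [sF' F1] := sF.
have sA := smooth_on_adj2 oO sF'.
split.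
  have := smooth_on_mulmx oO sA (smooth_on_derive ((1, 0) : R * R) sF').
  apply: smooth_on_ext => // p Op; apply: etrans (adj2_mulKmx (U p) (F1 p Op)).
  by congr (_ *m _); exact: (MC_dx sF MC Op).
have := smooth_on_mulmx oO sA (smooth_on_derive ((0, 1) : R * R) sF').
apply: smooth_on_ext => // p Op; apply: etrans (adj2_mulKmx (V p) (F1 p Op)).
  by congr (_ *m _); exact: (MC_dy sF MC Op).
Qed.

(** Differentiate [F_x = F U] in [y] and [F_y = F V] in [x], equate by symmetry, and cancel [F]. *)
Lemma MC_flat Omega F U V p Uy Vx : open Omega -> smooth_SL2_map Omega F ->
  has_MC_form Omega F U V -> Omega p ->
  is_derive p (0, 1) U Uy -> is_derive p (1, 0) V Vx ->
  V p *m U p + Uy = U p *m V p + Vx.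
Proof.
move=> oO sF MC Op DU DV; have [sF' F1] := sF.
have nO : \forall q \near p, Omega q by exact: open_nbhs_nbhs.
have Dx := MC_is_derive (1, 0) sF MC Op.
have Dy := MC_is_derive (0, 1) sF MC Op.
rewrite /= scale1r scale0r addr0 in Dx; rewrite /= scale1r scale0r add0r in Dy.
have Dxy : 'D_(0, 1) ('D_(1, 0) F) p = F p *m (V p *m U p + Uy).
  have /(@derive_val _ _ _ _ _ _ _) := is_derive_mulmx Dy DU.
  rewrite -mulmxA -mulmxDr => <-; apply: near_eq_derive.
  by apply: filterS nO => q Oq; exact: (MC_dx sF MC Oq).
have Dyx : 'D_(1, 0) ('D_(0, 1) F) p = F p *m (U p *m V p + Vx).
  have /(@derive_val _ _ _ _ _ _ _) := is_derive_mulmx Dx DV.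
  rewrite -mulmxA -mulmxDr => <-; apply: near_eq_derive.
  by apply: filterS nO => q Oq; exact: (MC_dy sF MC Oq).
have sym := derive_sym_mx ((1, 0) : R * R) (0, 1) oO Op sF'.
have FE := etrans (esym Dxy) (etrans sym Dyx).
apply: etrans (esym (adj2_mulKmx _ (F1 p Op))) _.
exact: etrans (congr1 (mulmx (adj2 (F p))) FE) (adj2_mulKmx _ (F1 p Op)).
Qed.

Lemma MC_unique Omega E G U V : open Omega -> connected Omega ->
  smooth_SL2_map Omega E -> smooth_SL2_map Omega G ->
  has_MC_form Omega E U V -> has_MC_form Omega G U V ->
  (forall p, Omega p -> \tr (U p) = 0 /\ \tr (V p) = 0) ->
  exists2 C : 'M[R]_2, SL2 C & forall p, Omega p -> E p = C *m G p.
Proof.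
move=> oO cO sE sG mE mG tUV; have [sE' E1] := sE; have [sG' G1] := sG.
(* An empty [Omega] has no base point, and the identity serves as [C]. *)
have [[p0 Op0]|nO] := pselect (exists p, Omega p); last first.
  by exists 1%:M; [rewrite /SL2/= det1|move=> p Op; case: nO; exists p].
(* The factor [1%:M] gives [H] the shape of [is_derive_conj] with constant [K]; the derivative then
   contains the commutator of [W] with the identity, which is 0. *)
pose H q := E q *m 1%:M *m adj2 (G q).
have H1 p : Omega p -> SL2 (H p).
  move=> Op; apply: SL2M; first by rewrite mulmx1; exact: E1.
  by rewrite /SL2/= det_adj2; exact: G1.
exists (H p0); first exact: H1.
move=> p Op; rewrite (@derive0_connected_mx _ _ _ _ Omega H oO cO _ _ p0 p)//.
- by rewrite /H mulmx1 -mulmxA mul_adj2mx ?mulmx1//; exact: G1.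
- move=> q Oq; apply: (@smooth_on_differentiable _ _ _ Omega) => //.
  apply: smooth_on_mulmx => //; last exact: smooth_on_adj2.
  by apply: smooth_on_mulmx => //; exact: smooth_on_cst.
move=> q v Oq; apply: (@derive_val _ _ _ _ _ _ _).
have W0 : \tr (v.1 *: U q + v.2 *: V q) = 0.
  by have [tU tV] := tUV q Oq; rewrite mxtraceD !mxtraceZ tU tV !mulr0 addr0.
have /is_derive_eq := is_derive_conj W0 (MC_is_derive v sE mE Oq)
  (MC_is_derive v sG mG Oq) (is_derive_cst (1%:M : 'M[R]_2) q v).
by apply; rewrite mulmx1 mul1mx subrr addr0 mulmx0 mul0mx.
Qed.

Lemma memv_kk (c : R) : c *: e3 \in kk.
Proof. by rewrite memvZ// memv_line. Qed.

Lemma memv_pp (a b : R) : a *: xi1 + b *: xi2 \in pp.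
Proof.
have -> : a *: xi1 + b *: xi2 = ((a - b) / 2) *: e1 + ((a + b) / 2) *: e2.
  by rewrite xi1E xi2E e1E /e2 !mx22E; congr mx22; field.
by apply: memvD; apply: memvZ; apply: memv_span; rewrite !inE eqxx ?orbT.
Qed.

End Maurer_Cartan.

(** * Harmonicity of [nu] and the Maurer-Cartan form of [G_of Fh] *)

Section Admissible_frame.
Context {R : realType}.
Variables (Omega : set (R * R)) (Fh : R -> R * R -> 'M[R]_2).
Variables (A1 A2 A3 B1 B2 B3 : R * R -> R).
Hypothesis oO : open Omega.
Hypothesis hFh : admissible_extended_frame Omega Fh A1 A2 A3 B1 B2 B3.

Let U (l : R) p : 'M[R]_2 := (l * A1 p) *: xi1 + A2 p *: xi2 + A3 p *: e3.
Let V (l : R) p : 'M[R]_2 := B1 p *: xi1 + (l^-1 * B2 p) *: xi2 + B3 p *: e3.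

Let UE l p : U l p = mx22 (- A3 p) (A2 p) (l * A1 p) (A3 p).
Proof. by rewrite /U e3E xi1E xi2E !mx22E; congr mx22; ring. Qed.

Let VE l p : V l p = mx22 (- B3 p) (l^-1 * B2 p) (B1 p) (B3 p).
Proof. by rewrite /V e3E xi1E xi2E !mx22E; congr mx22; ring. Qed.

Let MC_Fh l : l != 0 -> has_MC_form Omega (Fh l) (U l) (V l).
Proof. by have [_ _] := hFh; exact. Qed.

Lemma smooth_Fh l : l != 0 -> smooth_SL2_map Omega (Fh l).
Proof.
have [sF F1 _] := hFh => l0; split; last by move=> p; exact: F1.
apply/smooth_onP => n.
(* The inclusion of the slice at [l], and its linear part. *)
pose i (p : R * R) := (p, l); pose j (p : R * R) := (p, 0 : R).
have /(@Cn_comp_affine _ _ _ _ _ _ _ i j) := (smooth_onP _ _).1 sF n.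
have -> : i @^-1` [set q | Omega q.1 /\ q.2 != 0] = Omega.
  by apply/seteqP; split=> p /=; [case|].
apply; first by move=> p; exact: differentiable_pair.
by move=> p v h; rewrite /i /j; congr (_, _); rewrite /= scaler0 add0r.
Qed.

Let F := Fh 1.
Let sF : smooth_SL2_map Omega F. Proof. exact: smooth_Fh (oner_neq0 _). Qed.

Let is_derive_coord (W : R * R -> 'M[R]_2) (h : R * R -> R) i j p v : smooth_on Omega W ->
  (forall q, W q i j = h q) -> Omega p -> is_derive p v h ('D_v h p).
Proof.
move=> sW Wh Op; have <- : (fun q => W q i j) = h by apply/funext.
apply/derivableP/diff_derivable.
have dW := smooth_on_differentiable sW Op.
exact: differentiable_comp dW (differentiable_coord _ i j).
Qed.

(* In the zero-curvature equation the [xi1] and [xi2] entries are affine in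
   [l] and [l^-1]; comparing [l = 1] with [l = 2] separates the coefficients. *)
Lemma is_derive_A1_A2 p : Omega p ->
  is_derive p (0, 1) A1 (- (2 * B3 p * A1 p)) /\
  is_derive p (0, 1) A2 (2 * B3 p * A2 p).
Proof.
move=> Op; have [sU sV] := smooth_on_MC oO sF (MC_Fh (oner_neq0 _)).
have DA1 : is_derive p (0, 1) A1 ('D_(0, 1) A1 p).
  by apply: (is_derive_coord (i := 1) (j := 0) _ sU) => // q; rewrite UE mxE/= mul1r.
have DA2 : is_derive p (0, 1) A2 ('D_(0, 1) A2 p).
  by apply: (is_derive_coord (i := 0) (j := 1) _ sU) => // q; rewrite UE mxE.
have DA3 : is_derive p (0, 1) A3 ('D_(0, 1) A3 p).
  by apply: (is_derive_coord (i := 1) (j := 1) _ sU) => // q; rewrite UE mxE.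
have DB1 : is_derive p (1, 0) B1 ('D_(1, 0) B1 p).
  by apply: (is_derive_coord (i := 1) (j := 0) _ sV) => // q; rewrite VE mxE.
have DB2 : is_derive p (1, 0) B2 ('D_(1, 0) B2 p).
  apply: (is_derive_coord (i := 0) (j := 1) _ sV) => // q.
  by rewrite VE mxE/= invr1 mul1r.
have DB3 : is_derive p (1, 0) B3 ('D_(1, 0) B3 p).
  by apply: (is_derive_coord (i := 1) (j := 1) _ sV) => // q; rewrite VE mxE.
move: ('D_(0, 1) A1 p) ('D_(0, 1) A2 p) ('D_(0, 1) A3 p) DA1 DA2 DA3
  ('D_(1, 0) B1 p) ('D_(1, 0) B2 p) ('D_(1, 0) B3 p) DB1 DB2 DB3.
move=> a1 a2 a3 DA1 DA2 DA3 b1 b2 b3 DB1 DB2 DB3.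
have flat l : l != 0 ->
    V l p *m U l p + mx22 (- a3) a2 (l * a1) a3 =
    U l p *m V l p + mx22 (- b3) (l^-1 * b2) b1 b3.
  move=> l0; have MC := MC_Fh l0.
  apply: MC_flat oO (smooth_Fh l0) MC Op _ _.
    have -> : U l = fun q => mx22 (- A3 q) (A2 q) (l * A1 q) (A3 q).
      by apply/funext => q; rewrite UE.
    exact: is_derive_mx22.
  have -> : V l = fun q => mx22 (- B3 q) (l^-1 * B2 q) (B1 q) (B3 q).
    by apply/funext => q; rewrite VE.
  exact: is_derive_mx22.
have n20 : 2 != 0 :> R by rewrite pnatr_eq0.
have := flat 1 (oner_neq0 _); have := flat 2 n20.
rewrite !UE !VE !mx22E => /mx22_inj[_ e2b e2c _] /mx22_inj[_ e1b e1c _].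
rewrite invr1 in e1b; split.
  by apply: is_derive_eq DA1 _; lra.
by apply: is_derive_eq DA2 _; lra.
Qed.

Lemma smooth_nu : smooth_on Omega (fun p => Ad (F p) e3).
Proof.
have [sF' F1] := sF.
have sn : smooth_on Omega (fun p => F p *m e3 *m adj2 (F p)).
  apply: smooth_on_mulmx => //; last exact: smooth_on_adj2.
  by apply: smooth_on_mulmx => //; exact: smooth_on_cst.
apply: smooth_on_ext sn => // p Op.
by rewrite /Ad (invmx_adj2 (F1 p Op)).
Qed.

Lemma harmonic_nu : harmonic_null Omega (fun p => Ad (F p) e3).
Proof.
have [sF' F1] := sF; have MC := MC_Fh (oner_neq0 _).
split; first exact: smooth_nu.
  move=> p Op; rewrite /Ad (invmx_adj2 (F1 p Op)).
  have trE X : \tr (F p *m X *m adj2 (F p)) = \tr X.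
    by rewrite mxtrace_mulC mulmxA mul_adj2mx ?mul1mx//; exact: F1.
  split; first by rewrite /sl2/= trE e3E tr22 addNr.
  rewrite /ip -!mulmxA (mulmxA (adj2 _)) mul_adj2mx ?mul1mx; last exact: F1.
  by rewrite (mulmxA e3) mulmxA trE e3E mx22M tr22; field.
move=> p Op; have nO : \forall q \near p, Omega q by exact: open_nbhs_nbhs.
(* [K] is the commutator of [U 1] with [e3], so that [nu_x = F K F^-1]. *)
pose K q : 'M[R]_2 := mx22 0 (2 * A2 q) (- (2 * A1 q)) 0.
have trU q : \tr (U 1 q) = 0 by rewrite UE tr22 addNr.
have trV q : \tr (V 1 q) = 0 by rewrite VE tr22 addNr.
have nuE q : Omega q -> F q *m e3 *m adj2 (F q) = Ad (F q) e3.
  by move=> Oq; rewrite /Ad (invmx_adj2 (F1 q Oq)).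
have dxnu q : Omega q ->
    dx (fun p => Ad (F p) e3) q = F q *m K q *m adj2 (F q).
  move=> Oq; have := MC_is_derive (1, 0) sF MC Oq.
  rewrite /= scale1r scale0r addr0 => Dx.
  have Dnu := is_derive_conj (trU q) Dx Dx (is_derive_cst (e3 : 'M[R]_2) q ((1, 0) : R * R)).
  have nq : \forall q' \near q, Omega q' by exact: open_nbhs_nbhs.
  rewrite /dx -(near_eq_derive _ (filterS nuE nq)) derive_val /=.
  congr (_ *m _ *m _); rewrite UE e3E /K !mx22E addr0.
  by congr mx22; ring.
have [DA1 DA2] := is_derive_A1_A2 Op.
set a1 := - _ in DA1; set a2 := _ * A2 p in DA2.
have DK : is_derive p (0, 1) K (mx22 0 (2 * a2) (- (2 * a1)) 0).
  exact: is_derive_mx22.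
have := MC_is_derive (0, 1) sF MC Op.
rewrite /= scale1r scale0r add0r => Dy.
have D2 := is_derive_conj (trV p) Dy Dy DK.
have -> : dy (dx (fun p => Ad (F p) e3)) p = F p *m
    (V 1 p *m K p - K p *m V 1 p + mx22 0 (2 * a2) (- (2 * a1)) 0) *m adj2 (F p).
  rewrite -(@derive_val _ _ _ _ _ _ _ D2); apply: near_eq_derive.
  by apply: filterS nO => q; exact: dxnu.
set M := (X in F p *m X *m _).
(* The derivatives [a1] and [a2] cancel the off-diagonal entries of the commutator of [V 1] with
   [K]; what remains is diagonal. *)
have cM : e3 *m M = M *m e3.
  rewrite /M VE /K e3E !mx22E /a1 /a2 invr1; congr mx22; ring.
rewrite /bracket -nuE// -!mulmxA.
rewrite !(mulmxA (adj2 (F p)) (F p)) mul_adj2mx ?mul1mx; last exact: F1.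
by rewrite (mulmxA e3) (mulmxA M) cM subrr.
Qed.

Lemma G_of_frame z : z != 0 -> smooth_SL2_map Omega (G_of Fh z) /\
  has_MC_form Omega (G_of Fh z)
    (fun p => A3 p *: e3 + z *: (A1 p *: xi1 + A2 p *: xi2))
    (fun p => B3 p *: e3 + z^-1 *: (B1 p *: xi1 + B2 p *: xi2)).
Proof.
move=> z0; have [P [s [r [sE r0 zE detP GE]]]] := G_of_factor Fh z0.
have z20 : z ^+ 2 != 0 by rewrite expf_neq0.
have sFz := smooth_Fh z20; have [sFz' F1] := sFz.
have MC := MC_Fh z20.
have {}GE : G_of Fh z = fun p => P *m Fh (z ^+ 2) p *m twist s r.
  by apply/funext.
have sG : smooth_SL2_map Omega (G_of Fh z).
  rewrite GE; split.
    by do ?[apply: smooth_on_mulmx => //; last exact: smooth_on_cst];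
      apply: smooth_on_mulmx => //; exact: smooth_on_cst.
  move=> p Op; rewrite /SL2/= !det_mulmx detP (F1 p Op) /twist det22.
  by rewrite mulr1 divfK// mul0r subr0; case: sE => ->; ring.
split=> //; apply: is_derive_MC => // p v Op; rewrite GE.
have := is_derive_mulmxr (twist s r)
  (is_derive_mulmxl P (MC_is_derive v sFz MC Op)).
move=> /is_derive_eq; apply; rewrite -!mulmxA; congr (_ *m (_ *m _)).
rewrite mulmxDl mulmxDr -!scalemxAl -!scalemxAr.
have [eU _] := @twist_intertwine _ s r (A1 p) (A2 p) (A3 p) sE r0.
have [_ eV] := @twist_intertwine _ s r (B1 p) (B2 p) (B3 p) sE r0.
by rewrite zE eU eV.
Qed.

Lemma G_of1 p : G_of Fh 1 p = Fh 1 p.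
Proof.
by rewrite /G_of ltr01 expr1n ln1 mulr0 expmx_e3 oppr0 expR0 -mx22_1 mulmx1.
Qed.

End Admissible_frame.

Theorem lemma5p8 (R : realType) (Omega : set (R * R))
    (Fh : R -> R * R -> 'M[R]_2) (A1 A2 A3 B1 B2 B3 : R * R -> R)
    (hOmega : domain Omega)
    (hFh : admissible_extended_frame Omega Fh A1 A2 A3 B1 B2 B3) :
  let F := Fh 1 in
  let nu := fun p => Ad (F p) e3 in
  let G := G_of Fh in
  let beta0 := fun p => A3 p *: e3 in
  let beta1 := fun p => A1 p *: xi1 + A2 p *: xi2 in
  let gamma0 := fun p => B3 p *: e3 in
  let gammam1 := fun p => B1 p *: xi1 + B2 p *: xi2 in
  [/\ forall z p, z != 0 -> Omega p -> SL2 (G z p),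
      forall p, Omega p -> G 1 p = F p,
      forall z, z != 0 ->
        has_MC_form Omega (G z)
          (fun p => A3 p *: e3 + z *: (A1 p *: xi1 + A2 p *: xi2))
          (fun p => B3 p *: e3 + z^-1 *: (B1 p *: xi1 + B2 p *: xi2)),
      harmonic_null Omega nu
    & extended_frame_of Omega nu F beta0 beta1 gamma0 gammam1 G /\
      (forall E : R -> R * R -> 'M[R]_2,
         extended_frame_of Omega nu F beta0 beta1 gamma0 gammam1 E ->
         exists C : R -> 'M[R]_2, forall z, z != 0 ->
           SL2 (C z) /\ forall p, Omega p -> E z p = C z *m G z p)].
Proof.
move=> F nu G beta0 beta1 gamma0 gammam1; have [oO cO] := hOmega.
have Gfr (z : R) (z0 : z != 0) := G_of_frame oO hFh z0.
have sF : smooth_SL2_map Omega F := smooth_Fh hFh (oner_neq0 _).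
have [_ F1] := sF.
split.
- by move=> z p z0 Op; have [[_ G1] _] := Gfr z z0; exact: G1.
- by move=> p _; exact: G_of1.
- by move=> z z0; have [] := Gfr z z0.
- exact: harmonic_nu oO hFh.
split.
  split.
  - by split.
  - move=> p Op; have [_ _ /(_ 1 (oner_neq0 _)) MC] := hFh.
    have eA (W : 'M[R]_2) : invmx (F p) *m (F p *m W) = W.
      by rewrite (invmx_adj2 (F1 p Op)) (adj2_mulKmx _ (F1 p Op)).
    split.
    + by split; [exact: memv_kk|exact: memv_pp].
    + by split; [exact: memv_kk|exact: memv_pp].
    + by rewrite (MC_dx sF MC Op) eA mul1r addrC.
    + by rewrite (MC_dy sF MC Op) eA invr1 mul1r addrC.
  - by move=> z z0; have [] := Gfr z z0.
  - by move=> p _; exact: G_of1.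
  - by move=> z z0; have [] := Gfr z z0.
move=> E [_ _ sE _ mE].
suff /choice[C HC] : forall z, exists C : 'M[R]_2, z != 0 ->
    SL2 C /\ forall p, Omega p -> E z p = C *m G z p by exists C.
(* Each [z] is treated separately, with the default 0 at the excluded parameter. *)
move=> z; have [->|z0] := eqVneq z 0; first by exists 0.
have [sG mG] := Gfr z z0.
have [|C C1 EC] := MC_unique oO cO (sE z z0) sG (mE z z0) mG; last by exists C.
move=> p Op; rewrite /beta0 /beta1 /gamma0 /gammam1 e3E xi1E xi2E !mx22E !tr22.
by split; ring.
Qed.
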